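(* Let $(\mathfrak a,\alpha,\beta)$ be a multiplicative Hom-Lie antialgebra and let $\omega=(\omega_0,\omega_1,\omega_2)$ be a triple of bilinear maps $\omega_0:\mathfrak a_0\times\mathfrak a_0\to\mathfrak a_0$, $\omega_1:\mathfrak a_0\times\mathfrak a_1\to\mathfrak a_1$, $\omega_2:\mathfrak a_1\times\mathfrak a_1\to\mathfrak a_0$. Then $\omega$ generates a $t$-parameter infinitesimal deformation of $(\mathfrak a,\alpha,\beta)$ if and only if the following two conditions hold: (i) $(\omega_0,\omega_1,\omega_2)$ defines a (multiplicative) Hom-Lie antialgebra structure on $\mathfrak a$ (with the same maps $\alpha,\beta$); (ii) $(\omega_0,\omega_1,\omega_2)$ is a 2-cocycle of $\mathfrak a$ with coefficients in the adjoint representation.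
   Context: The base field is algebraically closed of characteristic $0$. A Hom-Lie antialgebra $(\mathfrak a,\alpha,\beta)$ is a $\mathbb Z_2$-graded algebra $\mathfrak a=\mathfrak a_0\oplus\mathfrak a_1$, $\mathfrak a_i\cdot\mathfrak a_j\subset\mathfrak a_{i+j}$, which is supercommutative ($x\cdot x'=x'\cdot x$, $x\cdot y=y\cdot x$ for $x,x'\in\mathfrak a_0$, $y\in\mathfrak a_1$, and the product of odd elements, written $[y,y']$, satisfies $[y,y']=-[y',y]$), with linear maps $\alpha:\mathfrak a_0\to\mathfrak a_0$, $\beta:\mathfrak a_1\to\mathfrak a_1$ such that for all $x_i\in\mathfrak a_0$, $y_i\in\mathfrak a_1$: (1) $\alpha(x_1)\cdot(x_2\cdot x_3)=(x_1\cdot x_2)\cdot\alpha(x_3)$; (2) $\alpha(x_1)\cdot(x_2\cdot y_1)=\frac12(x_1\cdot x_2)\cdot\beta(y_1)$; (3) $\alpha(x_1)\cdot[y_1,y_2]=[x_1\cdot y_1,\beta(y_2)]+[\beta(y_1),x_1\cdot y_2]$; (4) $\beta(y_1)\cdot[y_2,y_3]+\beta(y_2)\cdot[y_3,y_1]+\beta(y_3)\cdot[y_1,y_2]=0$. It is multiplicative if $\alpha(x_1\cdot x_2)=\alpha(x_1)\cdot\alpha(x_2)$, $\beta(x_1\cdot y_1)=\alpha(x_1)\cdot\beta(y_1)$, $\alpha([y_1,y_2])=[\beta(y_1),\beta(y_2)]$. All Hom-Lie antialgebras are assumed multiplicative. A structure is determined by the three bilinear maps even$\times$even$\to$even, even$\times$odd$\to$odd,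 odd$\times$odd$\to$even; ''$(\omega_0,\omega_1,\omega_2)$ defines a Hom-Lie antialgebra structure'' means these three maps are taken to be $\omega_0,\omega_1,\omega_2$ (with the odd$\times$even product given by $y\cdot x:=x\cdot y$). **Deformation.** Put $x_1\cdot_t x_2=x_1\cdot x_2+t\,\omega_0(x_1,x_2)$, $x_1\cdot_t y_1=x_1\cdot y_1+t\,\omega_1(x_1,y_1)$, $[y_1,y_2]_t=[y_1,y_2]+t\,\omega_2(y_1,y_2)$. $\omega$ generates a $t$-parameter infinitesimal deformation of $(\mathfrak a,\alpha,\beta)$ if these operations make $\mathfrak a$, with the maps $\alpha,\beta$, a multiplicative Hom-Lie antialgebra (for all values of the parameter $t$). **2-cocycle with adjoint coefficients.** $\omega$ is a 2-cocycle of $\mathfrak a$ with coefficients in the adjoint representation ($\rho_0(x)x'=x\cdot x'$, $\rho_0(x)y=x\cdot y$, $\rho_1(y)x=y\cdot x$, $\rho_1(y)y'=[y,y']$) if, for all $x_i\in\mathfrak a_0$, $y_i\in\mathfrak a_1$, $\alpha\omega_0(x_1,x_2)=\omega_0(\alpha(x_1),\alpha(x_2))$, $\beta\omega_1(x_1,y_1)=\omega_1(\alpha(x_1),\beta(y_1))$, $\alpha\omega_2(y_1,y_2)=\omega_2(\beta(y_1),\beta(y_2))$, and $\alpha(x_1)\cdot\omega_0(x_2,x_3)+\omega_0(\alpha(x_1),x_2\cdot x_3)=\omega_0(x_1,x_2)\cdot\alpha(x_3)+\omega_0(x_1\cdot x_2,\alpha(x_3))$; $\alpha(x_1)\cdot\omega_1(x_2,y_1)+\omega_1(\alpha(x_1),x_2\cdot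 y_1)=\frac12\omega_0(x_1,x_2)\cdot\beta(y_1)+\frac12\omega_1(x_1\cdot x_2,\beta(y_1))$; $\omega_0(\alpha(x_1),[y_1,y_2])+\alpha(x_1)\cdot\omega_2(y_1,y_2)=[\omega_1(x_1,y_1),\beta(y_2)]+\omega_2(x_1\cdot y_1,\beta(y_2))+[\beta(y_1),\omega_1(x_1,y_2)]+\omega_2(\beta(y_1),x_1\cdot y_2)$; $\sum_{\mathrm{cyc}(1,2,3)}\big(\beta(y_1)\cdot\omega_2(y_2,y_3)+\omega_1([y_2,y_3],\beta(y_1))\big)=0$. *)

(* Defs.v *)
From HB Require Import structures.
From mathcomp Require Import all_boot all_order all_algebra.

Set Implicit Arguments.
Unset Strict Implicit.
Unset Printing Implicit Defensive.

Import GRing.Theory.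
Local Open Scope ring_scope.

Section PerturbedBilinear.
Variables (K : fieldType) (U V W : lmodType K).

Definition perturb (f g : {bilinear U -> V -> W}) (t : K) (u : U) (v : V) : W :=
  f u v + t *: g u v.

Variables (f g : {bilinear U -> V -> W}) (t : K).

Lemma perturb_is_bilinear :
  bilinear_for (GRing.Scale.Law.clone _ _ *:%R _)
               (GRing.Scale.Law.clone _ _ *:%R _) (perturb f g t).
Proof.
by split=> [v|u] a x y; rewrite /perturb /= ?linearPl ?linearPr /= !scalerDr
  !scalerA [t * a]mulrC addrACA.
Qed.

HB.instance Definition _ :=
  bilinear_isBilinear.Build K U V W _ _ (perturb f g t) perturb_is_bilinear.

End PerturbedBilinear.

(* The products even x even -> even, even x odd -> odd and odd x odd -> even on
   A0 (+) A1. They determine the whole product, the odd x even part being the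
   flip [mul10] of [mul01]. The same type serves for a triple omega =
   (omega_0, omega_1, omega_2) of bilinear maps. No symmetry is imposed here. *)
Record graded_mul (K : fieldType) (A0 A1 : lmodType K) := GradedMul {
  mul00 : {bilinear A0 -> A0 -> A0};
  mul01 : {bilinear A0 -> A1 -> A1};
  mul11 : {bilinear A1 -> A1 -> A0}
}.

Definition mul10 (K : fieldType) (A0 A1 : lmodType K) (m : graded_mul A0 A1)
  (y : A1) (x : A0) : A1 := mul01 m x y.

Section HomLieAntialgebra.
Variables (K : fieldType) (A0 A1 : lmodType K).
Implicit Types (m om : graded_mul A0 A1).
Implicit Types (alpha : {linear A0 -> A0}) (beta : {linear A1 -> A1}).

Record hom_lie_antialgebra m alpha beta : Prop := HomLieAntialgebra {
  hla_comm : forall x1 x2, mul00 m x1 x2 = mul00 m x2 x1;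
  hla_skew : forall y1 y2, mul11 m y1 y2 = - mul11 m y2 y1;
  hla_assoc : forall x1 x2 x3,
    mul00 m (alpha x1) (mul00 m x2 x3) = mul00 m (mul00 m x1 x2) (alpha x3);
  hla_half : forall x1 x2 y1,
    mul01 m (alpha x1) (mul01 m x2 y1) =
    2%:R^-1 *: mul01 m (mul00 m x1 x2) (beta y1);
  hla_leibniz : forall x1 y1 y2,
    mul00 m (alpha x1) (mul11 m y1 y2) =
    mul11 m (mul01 m x1 y1) (beta y2) + mul11 m (beta y1) (mul01 m x1 y2);
  hla_jacobi : forall y1 y2 y3,
    mul10 m (beta y1) (mul11 m y2 y3) + mul10 m (beta y2) (mul11 m y3 y1)
      + mul10 m (beta y3) (mul11 m y1 y2) = 0
}.

(* For any bilinear triple m; on a product it is multiplicativity, on a cochain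
   it is compatibility with the twisting maps. *)
Record twist_compatible m alpha beta : Prop := TwistCompatible {
  twist00 : forall x1 x2,
    alpha (mul00 m x1 x2) = mul00 m (alpha x1) (alpha x2);
  twist01 : forall x1 y1,
    beta (mul01 m x1 y1) = mul01 m (alpha x1) (beta y1);
  twist11 : forall y1 y2,
    alpha (mul11 m y1 y2) = mul11 m (beta y1) (beta y2)
}.

Definition multiplicative_hom_lie_antialgebra m alpha beta : Prop :=
  hom_lie_antialgebra m alpha beta /\ twist_compatible m alpha beta.

Definition deform m om (t : K) : graded_mul A0 A1 :=
  {| mul00 := perturb (mul00 m) (mul00 om) t;
     mul01 := perturb (mul01 m) (mul01 om) t;
     mul11 := perturb (mul11 m) (mul11 om) t |}.

Definition generates_infinitesimal_deformation m alpha beta om : Prop :=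
  forall t : K, multiplicative_hom_lie_antialgebra (deform m om t) alpha beta.

Record adjoint_2cocycle m alpha beta om : Prop := Adjoint2Cocycle {
  cocycle_twist : twist_compatible om alpha beta;
  cocycle_assoc : forall x1 x2 x3,
    mul00 m (alpha x1) (mul00 om x2 x3) + mul00 om (alpha x1) (mul00 m x2 x3) =
    mul00 m (mul00 om x1 x2) (alpha x3) + mul00 om (mul00 m x1 x2) (alpha x3);
  cocycle_half : forall x1 x2 y1,
    mul01 m (alpha x1) (mul01 om x2 y1) + mul01 om (alpha x1) (mul01 m x2 y1) =
    2%:R^-1 *: mul01 m (mul00 om x1 x2) (beta y1)
      + 2%:R^-1 *: mul01 om (mul00 m x1 x2) (beta y1);
  cocycle_leibniz : forall x1 y1 y2,
    mul00 om (alpha x1) (mul11 m y1 y2) + mul00 m (alpha x1) (mul11 om y1 y2) =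
    mul11 m (mul01 om x1 y1) (beta y2) + mul11 om (mul01 m x1 y1) (beta y2)
      + mul11 m (beta y1) (mul01 om x1 y2) + mul11 om (beta y1) (mul01 m x1 y2);
  cocycle_jacobi : forall y1 y2 y3,
    (mul10 m (beta y1) (mul11 om y2 y3) + mul01 om (mul11 m y2 y3) (beta y1))
      + (mul10 m (beta y2) (mul11 om y3 y1) + mul01 om (mul11 m y3 y1) (beta y2))
      + (mul10 m (beta y3) (mul11 om y1 y2) + mul01 om (mul11 m y1 y2) (beta y3))
    = 0
}.

End HomLieAntialgebra.

(* Main.v *)
Require Import Defs.
From mathcomp Require Import all_boot all_order all_algebra.

Set Implicit Arguments.
Unset Strict Implicit.

Import GRing.Theory.
Local Open Scope ring_scope.

(** Each axiom of a Hom-Lie antialgebra is either linear in the product (the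
symmetry axioms and multiplicativity) or quadratic in it (the four Hom
identities). After replacing the product [m] by [m + t omega], a quadratic
axiom is therefore an equality of two vector-valued polynomials of degree at
most two in [t]:
- the coefficient of [t^0] is the axiom for [m], which holds by hypothesis;
- the coefficient of [t^1] is the polarized axiom, one product taken in [m] and
  the other in [omega], and this is exactly a 2-cocycle identity;
- the coefficient of [t^2] is the axiom for [omega].
Likewise the [t]-coefficient of a linear axiom is that axiom for [omega]. So the
theorem amounts to comparing coefficients, [quad_eqP] and [affine_eqP]: the
former needs the two parameter values 1 and -1 to be distinct, and this is where
the characteristic enters. *)

Section CoefficientComparison.
Variables (K : fieldType) (V : lmodType K).

Definition quad (t : K) (a b c : V) : V := a + t *: b + t ^+ 2 *: c.

Lemma quadD t a b c a' b' c' :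
  quad t a b c + quad t a' b' c' = quad t (a + a') (b + b') (c + c').
Proof. by rewrite /quad !scalerDr addrACA [X in X + _]addrACA. Qed.

Lemma quadZ k t a b c : k *: quad t a b c = quad t (k *: a) (k *: b) (k *: c).
Proof. by rewrite /quad !scalerDr !scalerA ![k * _]mulrC. Qed.

Lemma affine_eqP (a a' b b' : V) :
  a = a' -> (forall t : K, a + t *: b = a' + t *: b') <-> b = b'.
Proof.
move=> ->; split=> [eq_t|-> //].
by move/addrI: (eq_t 1); rewrite !scale1r.
Qed.

(** Once the constant terms agree, evaluating at 1 and -1 yields the sum and the
difference of the other two coefficients; halving separates them. *)
Lemma quad_eqP (a a' b b' c c' : V) : 2%:R != 0 :> K -> a = a' ->
  (forall t, quad t a b c = quad t a' b' c') <-> b = b' /\ c = c'.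
Proof.
move=> nz2 ->; split=> [eq_t|[-> ->] //].
have eqD : b + c = b' + c'.
  by have := eq_t 1; rewrite /quad expr1n !scale1r -!addrA => /addrI.
have eqB : - b + c = - b' + c'.
  by have := eq_t (-1); rewrite /quad sqrrN expr1n !scaleN1r !scale1r -!addrA
    => /addrI.
have eqc : c = c'.
  apply: (scalerI nz2); rewrite !scaler_nat !mulr2n.
  by have := congr2 +%R eqD eqB; rewrite !(addrACA _ _ (- _)) !subrr !add0r.
by split=> //; move: eqD; rewrite eqc => /addIr.
Qed.

End CoefficientComparison.

Section PerturbedComposites.
Variables (K : fieldType) (U V W X Y : lmodType K) (t : K).

(** A Hom identity nests two products, to the right here and to the left in
[perturb_compl]; the mixed terms are where the shape of the cocycle identities
comes from. *)
Lemma perturb_compr (f g : {bilinear U -> X -> Y}) (f' g' : {bilinear V -> W -> X})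
    u v w :
  perturb f g t u (perturb f' g' t v w) =
  quad t (f u (f' v w)) (f u (g' v w) + g u (f' v w)) (g u (g' v w)).
Proof.
by rewrite /perturb /quad !linearDr !linearZr_LR /= !scalerDr scalerA !addrA.
Qed.

Lemma perturb_compl (f g : {bilinear X -> U -> Y}) (f' g' : {bilinear V -> W -> X})
    v w u :
  perturb f g t (perturb f' g' t v w) u =
  quad t (f (f' v w) u) (f (g' v w) u + g (f' v w) u) (g (g' v w) u).
Proof.
by rewrite /perturb /quad !linearDl !linearZl_LR /= !scalerDr scalerA !addrA.
Qed.

End PerturbedComposites.

Section Deformation.
Variables (K : fieldType) (A0 A1 : lmodType K).
Variables (m om : graded_mul A0 A1).
Variables (alpha : {linear A0 -> A0}) (beta : {linear A1 -> A1}).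
Hypothesis nz2 : 2%:R != 0 :> K.
Hypothesis Hm : multiplicative_hom_lie_antialgebra m alpha beta.

Let md := deform m om.
Let Hla := Hm.1.
Let Htw := Hm.2.

Lemma deform_commP x1 x2 :
  (forall t, mul00 (md t) x1 x2 = mul00 (md t) x2 x1) <->
  mul00 om x1 x2 = mul00 om x2 x1.
Proof. exact/affine_eqP/(hla_comm Hla). Qed.

Lemma deform_skewP y1 y2 :
  (forall t, mul11 (md t) y1 y2 = - mul11 (md t) y2 y1) <->
  mul11 om y1 y2 = - mul11 om y2 y1.
Proof.
apply: iff_trans (affine_eqP _ _ (hla_skew Hla y1 y2)).
by split=> E t; have := E t; rewrite /= /perturb opprD scalerN.
Qed.

Lemma deform_twistP :
  (forall t, twist_compatible (md t) alpha beta) <-> twist_compatible om alpha beta.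
Proof.
have E00 x1 x2 := affine_eqP (alpha (mul00 om x1 x2))
  (mul00 om (alpha x1) (alpha x2)) (twist00 Htw x1 x2).
have E01 x y := affine_eqP (beta (mul01 om x y))
  (mul01 om (alpha x) (beta y)) (twist01 Htw x y).
have E11 y1 y2 := affine_eqP (alpha (mul11 om y1 y2))
  (mul11 om (beta y1) (beta y2)) (twist11 Htw y1 y2).
split=> [H|[H00 H01 H11] t].
  split=> [x1 x2|x y|y1 y2].
  - by apply/E00 => t; rewrite -linearZ -linearD; apply: (twist00 (H t)).
  - by apply/E01 => t; rewrite -linearZ -linearD; apply: (twist01 (H t)).
  - by apply/E11 => t; rewrite -linearZ -linearD; apply: (twist11 (H t)).
split=> [x1 x2|x y|y1 y2]; rewrite /= /perturb linearD linearZ /=.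
- by apply: (E00 _ _).2.
- by apply: (E01 _ _).2.
- by apply: (E11 _ _).2.
Qed.

(** In this and the following equivalences the first conjunct is the coefficient
of [t], a cocycle identity, and the second is the coefficient of [t ^+ 2], the
axiom for [om]; the constant terms agree because [m] satisfies the axiom. *)
Lemma deform_assocP x1 x2 x3 :
  (forall t, mul00 (md t) (alpha x1) (mul00 (md t) x2 x3) =
             mul00 (md t) (mul00 (md t) x1 x2) (alpha x3)) <->
  mul00 m (alpha x1) (mul00 om x2 x3) + mul00 om (alpha x1) (mul00 m x2 x3) =
  mul00 m (mul00 om x1 x2) (alpha x3) + mul00 om (mul00 m x1 x2) (alpha x3) /\
  mul00 om (alpha x1) (mul00 om x2 x3) = mul00 om (mul00 om x1 x2) (alpha x3).
Proof.
apply: iff_trans (quad_eqP _ _ _ _ nz2 (hla_assoc Hla x1 x2 x3)).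
by split=> E t; have := E t; rewrite /= perturb_compr perturb_compl.
Qed.

Lemma deform_halfP x1 x2 y :
  (forall t, mul01 (md t) (alpha x1) (mul01 (md t) x2 y) =
             2%:R^-1 *: mul01 (md t) (mul00 (md t) x1 x2) (beta y)) <->
  mul01 m (alpha x1) (mul01 om x2 y) + mul01 om (alpha x1) (mul01 m x2 y) =
  2%:R^-1 *: mul01 m (mul00 om x1 x2) (beta y)
    + 2%:R^-1 *: mul01 om (mul00 m x1 x2) (beta y) /\
  mul01 om (alpha x1) (mul01 om x2 y) =
  2%:R^-1 *: mul01 om (mul00 om x1 x2) (beta y).
Proof.
rewrite -scalerDr; apply: iff_trans (quad_eqP _ _ _ _ nz2 (hla_half Hla x1 x2 y)).
by split=> E t; have := E t; rewrite /= perturb_compr perturb_compl quadZ.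
Qed.

Lemma deform_leibnizP x y1 y2 :
  (forall t, mul00 (md t) (alpha x) (mul11 (md t) y1 y2) =
             mul11 (md t) (mul01 (md t) x y1) (beta y2)
               + mul11 (md t) (beta y1) (mul01 (md t) x y2)) <->
  mul00 om (alpha x) (mul11 m y1 y2) + mul00 m (alpha x) (mul11 om y1 y2) =
  mul11 m (mul01 om x y1) (beta y2) + mul11 om (mul01 m x y1) (beta y2)
    + mul11 m (beta y1) (mul01 om x y2) + mul11 om (beta y1) (mul01 m x y2) /\
  mul00 om (alpha x) (mul11 om y1 y2) =
  mul11 om (mul01 om x y1) (beta y2) + mul11 om (beta y1) (mul01 om x y2).
Proof.
rewrite [mul00 om _ _ + _]addrC -[X in _ = X /\ _]addrA.
apply: iff_trans (quad_eqP _ _ _ _ nz2 (hla_leibniz Hla x y1 y2)).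
by split=> E t; have := E t; rewrite /= !perturb_compr perturb_compl quadD.
Qed.

Lemma deform_jacobiP y1 y2 y3 :
  (forall t, mul10 (md t) (beta y1) (mul11 (md t) y2 y3)
               + mul10 (md t) (beta y2) (mul11 (md t) y3 y1)
               + mul10 (md t) (beta y3) (mul11 (md t) y1 y2) = 0) <->
  (mul10 m (beta y1) (mul11 om y2 y3) + mul01 om (mul11 m y2 y3) (beta y1))
    + (mul10 m (beta y2) (mul11 om y3 y1) + mul01 om (mul11 m y3 y1) (beta y2))
    + (mul10 m (beta y3) (mul11 om y1 y2) + mul01 om (mul11 m y1 y2) (beta y3))
  = 0 /\
  mul10 om (beta y1) (mul11 om y2 y3) + mul10 om (beta y2) (mul11 om y3 y1)
    + mul10 om (beta y3) (mul11 om y1 y2) = 0.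
Proof.
have quad0 t : quad t 0 0 0 = 0 :> A1 by rewrite /quad !scaler0 !addr0.
apply: iff_trans (quad_eqP _ _ _ _ nz2 (hla_jacobi Hla y1 y2 y3)).
by split=> E t; have := E t; rewrite /mul10 /= !perturb_compl !quadD quad0.
Qed.

End Deformation.

Unset Implicit Arguments.
Set Strict Implicit.

Theorem theorem2 (K : closedFieldType) (charK0 : [pchar K] =i pred0)
    (A0 A1 : lmodType K) (m : graded_mul A0 A1)
    (alpha : {linear A0 -> A0}) (beta : {linear A1 -> A1})
    (Hm : multiplicative_hom_lie_antialgebra m alpha beta)
    (omega : graded_mul A0 A1) :
  generates_infinitesimal_deformation m alpha beta omega <->
  multiplicative_hom_lie_antialgebra omega alpha beta /\
  adjoint_2cocycle m alpha beta omega.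
Proof.
have nz2 : 2%:R != 0 :> K by rewrite ((pcharf0P K).1 charK0).
have commP := deform_commP omega Hm.
have skewP := deform_skewP omega Hm.
have twistP := deform_twistP omega Hm.
have assocP := deform_assocP omega nz2 Hm.
have halfP := deform_halfP omega nz2 Hm.
have leibnizP := deform_leibnizP omega nz2 Hm.
have jacobiP := deform_jacobiP omega nz2 Hm.
split=> [H|[[[comm skew assoc half leib jac] tw] [_ cassoc chalf cleib cjac]] t].
  have tw : twist_compatible omega alpha beta by apply/twistP => t; case: (H t).
  have H1 t := (H t).1.
  have assoc x1 x2 x3 := (assocP x1 x2 x3).1 (fun t => hla_assoc (H1 t) x1 x2 x3).
  have half x1 x2 y := (halfP x1 x2 y).1 (fun t => hla_half (H1 t) x1 x2 y).
  have leib x y1 y2 := (leibnizP x y1 y2).1 (fun t => hla_leibniz (H1 t) x y1 y2).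
  have jac y1 y2 y3 := (jacobiP y1 y2 y3).1 (fun t => hla_jacobi (H1 t) y1 y2 y3).
  split; first split=> //; split=> // *.
  - by apply/commP => t; apply: hla_comm (H1 t) _ _.
  - by apply/skewP => t; apply: hla_skew (H1 t) _ _.
  - exact: (assoc _ _ _).2.
  - exact: (half _ _ _).2.
  - exact: (leib _ _ _).2.
  - exact: (jac _ _ _).2.
  - exact: (assoc _ _ _).1.
  - exact: (half _ _ _).1.
  - exact: (leib _ _ _).1.
  - exact: (jac _ _ _).1.
split; last exact: twistP.2.
split=> *.
- exact: (commP _ _).2.
- exact: (skewP _ _).2.
- exact: (assocP _ _ _).2.
- exact: (halfP _ _ _).2.
- exact: (leibnizP _ _ _).2.
- exact: (jacobiP _ _ _).2.
Qed.
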